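(* Let $m\ge1$ be an integer, $y>0$, and $X\sim\mathrm{CMP}\big((y/m)^m,m\big)$. Then for all integers $n\ge0$, with $r=n\bmod m$, $$\mathbb E\big[(mX)^{\underline{\underline n}_m}\big]=y^n\,\frac{C^{(m)}_r(y)}{C^{(m)}_0(y)}.$$ In particular, for $m=1$: $\mathbb E[X^{\underline n}]=y^n$; and for $m=2$: $\mathbb E\big[(2X)^{\underline{\underline n}_2}\big]$ equals $y^n$ for $n$ even and $y^n\,I_1(y)/I_0(y)$ for $n$ odd.
   Context: The Conway--Maxwell--Poisson distribution $\mathrm{CMP}(\lambda,\nu)$ (with $\lambda,\nu>0$) has probability mass function $$\mathbb P(X=k)=\frac{\lambda^k}{(k!)^\nu Z(\lambda,\nu)},\quad k=0,1,2,\dots,\qquad Z(\lambda,\nu)=\sum_{j=0}^\infty\frac{\lambda^j}{(j!)^\nu}.$$ The $m$-falling factorial is $x^{\underline{\underline n}_m}=\prod_{k=0}^{n-1}\big(x-m\lfloor k/m\rfloor\big)$, and $x^{\underline n}=\prod_{k=0}^{n-1}(x-k)$ is the usual falling factorial. The hyper-Bessel carriers are $$C^{(m)}_0(x)=\sum_{k=0}^\infty\frac{(x/m)^{mk}}{(k!)^m},\qquad C^{(m)}_r(x)=\sum_{k=0}^\infty\frac{(x/m)^{mk+m-r}}{(k!)^r((k+1)!)^{m-r}}\quad(1\le r\le m-1).$$ $I_0,I_1$ are modified Bessel functions of the first kind. *)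

(* Defs.v *)
From HB Require Import structures.
From mathcomp Require Import all_boot all_order all_algebra.
From mathcomp Require Import all_classical all_reals all_analysis.

Set Implicit Arguments.
Unset Strict Implicit.
Unset Printing Implicit Defensive.

Import Order.TTheory GRing.Theory Num.Theory.
Import numFieldNormedType.Exports.

Local Open Scope classical_set_scope.
Local Open Scope ring_scope.

Section Defs.
Context {R : realType}.

Definition cmp_coeff (lambda nu : R) : R^nat :=
  [sequence lambda ^+ k / (k`!%:R `^ nu)]_k.

Definition cmp_Z (lambda nu : R) : R := limn (series (cmp_coeff lambda nu)).

(* The masses at 0, 1, 2, ... sum to 1 when 0 < lambda and 0 < nu, so they
   determine the law of X and force X to be almost surely a natural number. *)
Definition has_CMP_law d (T : measurableType d) (P : probability T R)
    (X : {RV P >-> R}) (lambda nu : R) : Prop :=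
  forall k : nat, pmf X k%:R = cmp_coeff lambda nu k / cmp_Z lambda nu.

Definition falling (x : R) (n : nat) : R := \prod_(k < n) (x - k%:R).

Definition mfalling (m : nat) (x : R) (n : nat) : R :=
  \prod_(k < n) (x - (m * (k %/ m))%:R).

(* C^(m)_r; meaningful for r < m. The case r = 0 is not an instance of the
   general formula, which would miss the constant term 1. *)
Definition hyperBesselC (m r : nat) (x : R) : R :=
  if r == 0%N then
    limn (series [sequence (x / m%:R) ^+ (m * k) / k`!%:R ^+ m]_k)
  else
    limn (series [sequence (x / m%:R) ^+ (m * k + m - r)
                    / (k`!%:R ^+ r * k.+1`!%:R ^+ (m - r))]_k).

(* Modified Bessel function of the first kind of integer order n, where
   Gamma (k + n + 1) = (k + n)!. *)
Definition besselI (n : nat) (x : R) : R :=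
  limn (series [sequence (x / 2) ^+ (2 * k + n) / (k`!%:R * (k + n)`!%:R)]_k).

End Defs.

(* Main.v *)
Require Import Defs.
From HB Require Import structures.
From mathcomp Require Import all_boot all_order all_algebra.
From mathcomp Require Import all_classical all_reals all_analysis.
From mathcomp Require Import measurable_realfun zify ring.

Set Implicit Arguments.
Unset Strict Implicit.
Unset Printing Implicit Defensive.

Import Order.TTheory GRing.Theory Num.Theory.
Import numFieldNormedType.Exports.

Local Open Scope classical_set_scope.
Local Open Scope ring_scope.

(** The m-falling factorial moments of X come from a cancellation inside each
    term of the defining series.

    Write n = q m + r with r < m. The floor of j / m is constant on blocks
    of m factors j, so at x = m k the m-falling factorial is made of q
    full blocks and one block of length r; pulling m out of every factor gives
      m ^ n * (k ^_ q) ^ (m - r) * (k ^_ (q + 1)) ^ r     ([mfalling_nat]).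
    The weight of k is (y / m) ^ (m k) / k! ^ m, up to normalisation. The m
    falling factorials above turn m - r of the m copies of k! in the
    denominator into (k - q)! and the other r copies into (k - q - 1)!. The
    terms with k < q, and also k = q if r > 0, vanish ([mfalling_nat_small]).
    Shifting the summation index to the first remaining term frees a factor
    (y / m) ^ n, which m ^ n completes to y ^ n, and leaves exactly the series
    of C^(m)_r ([mfalling_cmp_coeff_shift]). Dividing by the normalising
    constant, which is C^(m)_0 (y), yields the formula.

    The expectation is an integral over the whole probability space, on which
    X need not be integer-valued; [expectation_nat_valued] reduces it to a
    series over the natural numbers because the masses there add up to 1.
    The integrand is nonnegative at natural numbers, so monotone convergence
    gives integral and series at once, and the moment is finite because the
    series converges.

    For m = 1 only r = 0 occurs, and for m = 2 the series C^(2)_0 and C^(2)_1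
    are those of I_0 and I_1. *)

(** * The m-falling factorial at multiples of m *)

(** The case r = m, a full last block, is included so that the induction on q
    can absorb it. *)
Lemma mfalling_blocks (R : realType) (m : nat) (x : R) (q r : nat) :
  (0 < m)%N -> (r <= m)%N ->
  mfalling m x (q * m + r) =
  (\prod_(b < q) (x - (m * b)%:R)) ^+ m * (x - (m * q)%:R) ^+ r.
Proof.
move=> m0; elim: q r => [|q IHq] r rm.
  rewrite /mfalling mul0n add0n big_ord0 expr1n mul1r.
  rewrite -[r in RHS]card_ord -prodr_const; apply: eq_bigr => i _.
  by rewrite divn_small// (leq_trans _ rm).
rewrite big_ord_recr/= exprMn -(IHq m)// [(q * m + m)%N]addnC -mulSn.
rewrite /mfalling big_split_ord/=; congr (_ * _).
rewrite -[r in RHS]card_ord -prodr_const; apply: eq_bigr => i _.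
by rewrite divnMDl// divn_small ?addn0// (leq_trans _ rm).
Qed.

Lemma falling_nat (R : realType) (k q : nat) :
  falling (k%:R : R) q = (k ^_ q)%:R.
Proof.
elim: q => [|q IHq]; first by rewrite /falling big_ord0 ffactn0.
have -> : falling (k%:R : R) q.+1 = falling k%:R q * (k%:R - q%:R).
  by rewrite /falling big_ord_recr.
rewrite IHq ffactnSr natrM; have [qk|kq] := leqP q k; first by rewrite natrB.
by rewrite ffact_small// !mul0r.
Qed.

(** Splitting the r factors m (k - q) of the incomplete block among the
    q-fold falling factorials turns r of them into (q + 1)-fold ones. In this
    form the value is visibly nonnegative, and each falling factorial cancels
    against one k! in the weight of k. *)
Lemma mfalling_nat (R : realType) (m k n : nat) : (0 < m)%N ->
  mfalling m (m%:R * k%:R : R) n =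
  m%:R ^+ n *
  ((k ^_ (n %/ m)) ^ (m - n %% m) * (k ^_ (n %/ m).+1) ^ (n %% m))%:R.
Proof.
move=> m0; have rm : (n %% m <= m)%N by rewrite ltnW// ltn_mod.
rewrite [n in LHS](divn_eq n m) mfalling_blocks//.
have -> : \prod_(b < n %/ m) (m%:R * k%:R - (m * b)%:R) =
    m%:R ^+ (n %/ m) * (k ^_ (n %/ m))%:R :> R.
  rewrite -falling_nat; under eq_bigr do rewrite natrM -mulrBr.
  by rewrite big_split/= prodr_const card_ord.
rewrite (natrM _ m) -mulrBr !exprMn -exprM mulrACA -exprD -divn_eq.
congr (_ * _); rewrite natrM !natrX -!falling_nat.
rewrite [falling _ _.+1]big_ord_recr/= -/(falling _ _) exprMn mulrA.
by rewrite -exprD subnK.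
Qed.

Lemma mfalling_nat_small (R : realType) (m n k : nat) :
  (0 < m)%N -> (k < n %/ m + (n %% m != 0))%N ->
  mfalling m (m%:R * k%:R : R) n = 0.
Proof.
move=> m0; rewrite mfalling_nat//; case: eqVneq => [->|r0].
  by rewrite addn0 => kq; rewrite ffact_small// subn0 exp0n// mul0n mulr0.
rewrite addn1 => kq; rewrite [X in (_ * X ^ _)%N]ffact_small// exp0n ?lt0n//.
by rewrite muln0 mulr0.
Qed.

(** * The series of the hyper-Bessel carriers *)

(** The summands of C^(m)_r, named so that the case r = 0 and the general case
    can be handled by the same limit arguments. *)
Definition hyperBessel_coeff (R : realType) (m r : nat) (x : R) : R^nat :=
  if r == 0%N then [sequence (x / m%:R) ^+ (m * k) / k`!%:R ^+ m]_k
  else [sequence (x / m%:R) ^+ (m * k + m - r)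
                    / (k`!%:R ^+ r * k.+1`!%:R ^+ (m - r))]_k.

Lemma hyperBesselCE (R : realType) (m r : nat) (x : R) :
  hyperBesselC m r x = limn (series (hyperBessel_coeff m r x)).
Proof. by rewrite /hyperBesselC /hyperBessel_coeff; case: ifP. Qed.

Lemma cmp_coeff_hyperBessel (R : realType) (m : nat) (x : R) :
  cmp_coeff ((x / m%:R) ^+ m) m%:R = hyperBessel_coeff m 0 x.
Proof.
by apply/funext => k; rewrite /cmp_coeff /hyperBessel_coeff/= exprM powR_mulrn.
Qed.

Lemma hyperBessel_coeff_ge0 (R : realType) (m r : nat) (x : R) (k : nat) :
  0 <= x -> 0 <= hyperBessel_coeff m r x k.
Proof.
move=> x0; rewrite /hyperBessel_coeff; case: ifP => _ /=;
  by rewrite divr_ge0 ?mulr_ge0 ?exprn_ge0 ?divr_ge0.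
Qed.

(** Comparison with the exponential series at (x / m) ^ m: the denominators
    contain at least one factor k!, and the other factorials are at least 1. *)
Lemma hyperBessel_series_cvg (R : realType) (m r : nat) (x : R) :
  (0 < m)%N -> (r < m)%N -> 0 <= x ->
  cvgn (series (hyperBessel_coeff m r x)).
Proof.
move=> m0 rm x0.
have z0 : 0 <= x / m%:R by rewrite divr_ge0.
(* The power of x / m by which the terms of C^(m)_r exceed (x / m) ^ (m k). *)
pose c : R := if r == 0%N then 1 else (x / m%:R) ^+ (m - r).
have c0 : 0 <= c by rewrite /c; case: ifP => _ //; rewrite exprn_ge0.
apply: (@series_le_cvg _ _ (c *: exp_coeff ((x / m%:R) ^+ m))).
- by move=> k; exact: hyperBessel_coeff_ge0.
- by move=> k; rewrite /= mulr_ge0// divr_ge0// exprn_ge0// exprn_ge0.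
- have fact1 k : 1 <= k`!%:R :> R by rewrite ler1n fact_gt0.
  have fact_gt0R k : 0 < k`!%:R :> R by rewrite ltr0n fact_gt0.
  move=> k; rewrite /hyperBessel_coeff /c.
  case: ifP => [_|/negbT r0] /=.
    rewrite scale1r exprM.
    rewrite ler_wpM2l ?exprn_ge0// lef_pV2 ?posrE ?exprn_gt0//.
    by rewrite ler_eXnr.
  rewrite -addnBA 1?ltnW// exprD exprM.
  rewrite [_ ^+ _ * _ ^+ (m - r)]mulrC -mulrA.
  rewrite ler_wpM2l ?exprn_ge0// ler_wpM2l ?exprn_ge0//.
  rewrite lef_pV2 ?posrE ?mulr_gt0 ?exprn_gt0//.
  rewrite -[leLHS]mulr1 ler_pM ?ler0n//; first by rewrite ler_eXnr// lt0n.
  by rewrite exprn_ege1.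
- by apply: is_cvg_seriesZ; exact: is_cvg_series_exp_coeff.
Qed.

Lemma hyperBesselC0_gt0 (R : realType) (m : nat) (x : R) :
  (0 < m)%N -> 0 <= x -> 0 < hyperBesselC m 0 x.
Proof.
move=> m0 x0; rewrite hyperBesselCE.
apply: (@lt_le_trans _ _ (series (hyperBessel_coeff m 0 x) 1%N)).
  rewrite seriesEnat/= big_nat1 /hyperBessel_coeff/=.
  by rewrite muln0 expr0 expr1n divr1.
apply: nondecreasing_cvgn_le; last exact: hyperBessel_series_cvg.
by apply: nondecreasing_series => k _ _; exact: hyperBessel_coeff_ge0.
Qed.

(** * The moment series *)

Lemma cvg_series_shift (R : realType) (u : R^nat) (s : nat) (l : R) :
  (forall k, (k < s)%N -> u k = 0) ->
  series (fun k => u (s + k)%N) @ \oo --> l -> series u @ \oo --> l.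
Proof.
move=> u0 ul; rewrite -(cvg_shiftn s).
rewrite (_ : (fun n => _) = series (fun k => u (s + k)%N))//.
apply/funext => n; rewrite !seriesEnat/= (@big_cat_nat _ _ _ s) ?leq_addl//=.
rewrite [X in X + _]big_nat big1 ?add0r => [|k /= ks]; last exact: u0.
by rewrite -{1}[s]add0n big_addn addnK; apply: eq_bigr => k _; rewrite addnC.
Qed.

Lemma cvg_seriesZ (R : realType) (c : R) (u : R^nat) (l : R) :
  series u @ \oo --> l -> series (fun k => c * u k) @ \oo --> c * l.
Proof.
move=> ul; rewrite (_ : series _ = (fun n => c * series u n)).
  by apply: cvgM => //; exact: cvg_cst.
by apply/funext => n; rewrite seriesEnat/= big_distrr.
Qed.

(** The shift s is the number of vanishing terms: q of them when m divides n,
    and q + 1 when a (q + 1)-fold falling factorial occurs, where q = n / m. *)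
Lemma mfalling_cmp_coeff_shift (R : realType) (m n k : nat) (y : R) :
  (0 < m)%N ->
  let s := (n %/ m + (n %% m != 0))%N in
  mfalling m (m%:R * (s + k)%:R) n * cmp_coeff ((y / m%:R) ^+ m) m%:R (s + k) =
  y ^+ n * hyperBessel_coeff m (n %% m) y k.
Proof.
move=> m0 s.
have rm : (n %% m < m)%N by rewrite ltn_mod.
have mR0 : m%:R != 0 :> R by rewrite pnatr_eq0 -lt0n.
have fact0 j : j`!%:R != 0 :> R by rewrite pnatr_eq0 -lt0n fact_gt0.
have yE : y = m%:R * (y / m%:R) by rewrite mulrC divfK.
rewrite mfalling_nat// cmp_coeff_hyperBessel [in RHS]yE exprMn -!mulrA.
congr (_ * _); rewrite -yE /hyperBessel_coeff /= natrM !natrX.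
move: (y / m%:R) => x.
have [r0|r0] := eqVneq (n %% m)%N 0%N.
  have sE : s = (n %/ m)%N by rewrite /s r0 addn0.
  have nE : n = (m * s)%N by rewrite sE [LHS](divn_eq n m) r0 addn0 mulnC.
  have -> : ((s + k) ^_ (n %/ m))%:R = (s + k)`!%:R / k`!%:R :> R.
    by rewrite -sE -(ffact_fact (leq_addr k s)) addKn natrM mulfK.
  rewrite r0 subn0 expr0 mulr1 mulnDr exprD -nE expr_div_n.
  by field; rewrite ?expf_neq0.
have sE : s = (n %/ m).+1 by rewrite /s r0 addn1.
have -> : ((s + k) ^_ (n %/ m))%:R = (s + k)`!%:R / k.+1`!%:R :> R.
  have qs : (n %/ m <= s + k)%N by rewrite sE addSn leqW// leq_addr.
  by rewrite -(ffact_fact qs) sE addSnnS addKn natrM mulfK.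
have -> : ((s + k) ^_ (n %/ m).+1)%:R = (s + k)`!%:R / k`!%:R :> R.
  by rewrite -sE -(ffact_fact (leq_addr k s)) addKn natrM mulfK.
rewrite !expr_div_n.
have -> : (m * (s + k) = n + (m * k + m - n %% m))%N.
  have := divn_eq n m; rewrite sE; set q := (n %/ m)%N; nia.
rewrite exprD.
have -> : (s + k)`!%:R ^+ m =
    (s + k)`!%:R ^+ (m - n %% m) * (s + k)`!%:R ^+ (n %% m) :> R.
  by rewrite -exprD subnK// ltnW.
by field; rewrite ?expf_neq0.
Qed.

(** * Expectations as series *)

(** The fibres of X over the natural numbers are disjoint, and as their masses
    add up to 1 they cover the space up to a null set. On each fibre the
    integrand is constant, and it is nonnegative there even if f takes negative
    values elsewhere, so the integral splits countably. *)
Lemma expectation_nat_valued (R : realType) (d : measure_display)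
    (T : measurableType d) (P : probability T R) (X : {RV P >-> R})
    (f : R -> R) (l : R) :
  measurable_fun setT f -> (forall k : nat, 0 <= f k%:R) ->
  series (fun k => pmf X k%:R) @ \oo --> (1 : R) ->
  series (fun k => f k%:R * pmf X k%:R) @ \oo --> l ->
  'E_P[f \o X]%E = l%:E.
Proof.
move=> mf f0 X1 fl.
pose F k := X @^-1` [set (k%:R : R)].
have mF k : measurable (F k) by exact: measurable_funPTI.
have tF : trivIset setT F.
  by move=> i j _ _ [w [/= wi wj]]; apply/eqP; rewrite -(eqr_nat R) -wi -wj.
pose D := \bigcup_k F k.
have mD : measurable D by exact: bigcup_measurable.
have PF k : P (F k) = (pmf X k%:R)%:E by rewrite /pmf fineK// fin_num_measure.
have PD : P D = 1%E.
  rewrite /D measure_bigcup//.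
  rewrite (eq_eseriesl (Q := xpredT)); last by move=> i; rewrite in_setT.
  rewrite (eq_eseriesr (fun k _ => PF k)).
  apply: cvg_lim => //.
  rewrite (_ : (fun n => _) = EFin \o series (fun k => pmf X k%:R)).
    by apply: cvg_EFin => //; exact: nearW.
  by apply/funext => n; rewrite /= sumEFin.
have /measurable_EFinP mfX : measurable_fun setT (f \o X).
  exact: measurableT_comp.
rewrite unlock.
have -> : (\int[P]_w (f (X w))%:E = \int[P]_(w in D) (f (X w))%:E)%E.
  (* f may be negative off D, so the null complement is discarded by almost
     everywhere equality before nonnegativity comes in. *)
  rewrite [RHS]integral_mkcond; apply: ae_eq_integral => //.
    by apply/(measurable_restrictT _ _).1 => //; exact: measurable_funTS.
  exists (~` D); split; [exact: measurableC| |].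
    by have := probability_setC P mD; rewrite PD subee.
  by move=> w /= /not_implyP[_ nw] Dw; apply: nw; rewrite patchE mem_set.
rewrite ge0_integral_bigcup//; last 2 first.
- exact: measurable_funTS.
- by move=> w [k _ /= ->]; rewrite lee_fin.
have fk k : (\int[P]_(w in F k) (f (X w))%:E = (f k%:R * pmf X k%:R)%:E)%E.
  rewrite EFinM -PF -integral_cst//; apply: eq_integral => w.
  by rewrite inE => /= ->.
rewrite (eq_eseriesr (fun k _ => fk k)).
apply: cvg_lim => //.
rewrite (_ : (fun n => _) = EFin \o series (fun k => f k%:R * pmf X k%:R)).
  by apply: cvg_EFin => //; exact: nearW.
by apply/funext => n; rewrite /= sumEFin.
Qed.

Lemma measurable_mfalling (R : realType) (m n : nat) (a : R) :
  measurable_fun setT (fun x : R => mfalling m (a * x) n).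
Proof.
rewrite /mfalling; apply: measurable_prod => i _.
by apply: measurable_funB => //; exact: mulrl_measurable.
Qed.

Lemma expectation_mfalling_CMP (R : realType) (d : measure_display)
    (T : measurableType d) (P : probability T R) (X : {RV P >-> R})
    (m n : nat) (y : R) :
  (0 < m)%N -> 0 <= y -> has_CMP_law X ((y / m%:R) ^+ m) m%:R ->
  'E_P[fun w => mfalling m (m%:R * X w) n]%E =
  (y ^+ n * (hyperBesselC m (n %% m) y / hyperBesselC m 0 y))%:E.
Proof.
move=> m0 y0 hX.
pose Z := hyperBesselC m 0 y.
have Z0 : Z != 0 by rewrite gt_eqF// hyperBesselC0_gt0.
have pX k : pmf X k%:R = Z^-1 * hyperBessel_coeff m 0 y k.
  by rewrite hX /cmp_Z cmp_coeff_hyperBessel -hyperBesselCE mulrC.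
have cvgC r : (r < m)%N ->
    series (hyperBessel_coeff m r y) @ \oo --> hyperBesselC m r y.
  by move=> rm; rewrite hyperBesselCE; exact: hyperBessel_series_cvg.
apply: (@expectation_nat_valued _ _ _ _ _ (fun x => mfalling m (m%:R * x) n)).
- exact: measurable_mfalling.
- by move=> k; rewrite mfalling_nat// mulr_ge0// exprn_ge0.
- rewrite (_ : (fun k => _) = (fun k => Z^-1 * hyperBessel_coeff m 0 y k)).
    by rewrite -[X in _ --> X](mulVf Z0); apply: cvg_seriesZ; exact: cvgC.
  exact/funext.
- apply: (@cvg_series_shift _ _ (n %/ m + (n %% m != 0))%N) => [k ks|].
    by rewrite mfalling_nat_small// mul0r.
  rewrite (_ : (fun k => _) =
      (fun k => y ^+ n / Z * hyperBessel_coeff m (n %% m) y k)).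
    rewrite mulrA mulrAC; apply: cvg_seriesZ; apply: cvgC; exact: ltn_pmod.
  apply/funext => k; rewrite pX -cmp_coeff_hyperBessel mulrCA.
  by rewrite mfalling_cmp_coeff_shift// mulrCA mulrA.
Qed.

Theorem theorem8p2 (R : realType) (d : measure_display) (T : measurableType d)
    (P : probability T R) (X : {RV P >-> R}) (m : nat) (y : R)
    (hm : (1 <= m)%N) (hy : 0 < y)
    (hX : has_CMP_law X ((y / m%:R) ^+ m) m%:R) :
  (forall n : nat,
     'E_P[fun w => mfalling m (m%:R * X w) n]%E =
     (y ^+ n * (hyperBesselC m (n %% m) y / hyperBesselC m 0 y))%:E) /\
  (m = 1%N -> forall n : nat,
     'E_P[fun w => falling (X w) n]%E = (y ^+ n)%:E) /\
  (m = 2%N ->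
     (forall n : nat, ~~ odd n ->
        'E_P[fun w => mfalling 2 (2 * X w) n]%E = (y ^+ n)%:E) /\
     (forall n : nat, odd n ->
        'E_P[fun w => mfalling 2 (2 * X w) n]%E =
        (y ^+ n * (besselI 1 y / besselI 0 y))%:E)).
Proof.
have moment n := expectation_mfalling_CMP n hm (ltW hy) hX.
have C0 : hyperBesselC m 0 y != 0 by rewrite gt_eqF// hyperBesselC0_gt0// ltW.
split; [exact: moment|split=> [m1 n|m2]].
  rewrite [X in 'E_P[X]%E](_ : _ = fun w => mfalling m (m%:R * X w) n).
    by rewrite moment m1 modn1 -m1 divff// mulr1.
  apply/funext => w; apply: eq_bigr => i _.
  by rewrite m1 mul1r divn1 mul1n.
subst m; split=> n; rewrite moment modn2.
  by move=> /negbTE ->; rewrite divff ?mulr1.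
move=> ->; suff -> : hyperBesselC 2 1 y = besselI 1 y.
  suff -> : hyperBesselC 2 0 y = besselI 0 y by [].
  rewrite /hyperBesselC /besselI; congr (limn (series _)).
  by apply/funext => k /=; rewrite !addn0.
rewrite /hyperBesselC /besselI; congr (limn (series _)).
by apply/funext => k /=; rewrite -addnBA// expr1 !addn1.
Qed.
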